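(* For any convex set $\mathcal{W} \subseteq \mathcal{C}_{\rm ICC}$, there exists $\boldsymbol{\kappa} \in [0,1]^N$ such that $\mathcal{W} \subseteq \mathcal{C}_{\rm ICC}(\boldsymbol{\kappa}) \subseteq \mathcal{C}_{\rm ICC}$.
   Context: Data: a compact polyhedron $\mathcal{X} \subseteq \mathbb{R}^L$; a matrix $\boldsymbol{A} \in \mathbb{R}^{L\times K}$, vectors $\boldsymbol{a} \in \mathbb{R}^L$, $\boldsymbol{b} \in \mathbb{R}^K$ and a scalar $b_0 \in \mathbb{R}$ such that $\boldsymbol{A}^\top \boldsymbol{x} \neq \boldsymbol{b}$ for all $\boldsymbol{x} \in \mathcal{X}$; samples $\hat{\boldsymbol{\xi}}_1,\dots,\hat{\boldsymbol{\xi}}_N \in \mathbb{R}^K$; a risk threshold $\varepsilon \in (0,1)$; a radius $\theta \ge 0$; a norm $\|\cdot\|$ on $\mathbb{R}^K$ with dual norm $\|\cdot\|_*$. Write $[N]=\{1,\dots,N\}$, $\mathbf{e}$ for the all-ones vector and $(y)^+=\max\{y,0\}$. Define $$\mathcal{C}_{\rm ICC} = \left\{(\boldsymbol{x},\boldsymbol{s},t)\in\mathcal{X}\times\mathbb{R}^N_+\times\mathbb{R} \;:\; \varepsilon N t - \mathbf{e}^\top\boldsymbol{s} \ge \theta N \|\boldsymbol{b}-\boldsymbol{A}^\top\boldsymbol{x}\|_*,\; \big((\boldsymbol{b}-\boldsymbol{A}^\top\boldsymbol{x})^\top\hat{\boldsymbol{\xi}}_i + b_0 - \boldsymbol{a}^\top\boldsymbol{x}\big)^+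 \ge t - s_i \;\forall i\in[N]\right\}$$ and, for $\boldsymbol{\kappa}\in[0,1]^N$, $$\mathcal{C}_{\rm ICC}(\boldsymbol{\kappa}) = \left\{(\boldsymbol{x},\boldsymbol{s},t)\in\mathcal{X}\times\mathbb{R}^N_+\times\mathbb{R} \;:\; \varepsilon N t - \mathbf{e}^\top\boldsymbol{s} \ge \theta N \|\boldsymbol{b}-\boldsymbol{A}^\top\boldsymbol{x}\|_*,\; \kappa_i\big((\boldsymbol{b}-\boldsymbol{A}^\top\boldsymbol{x})^\top\hat{\boldsymbol{\xi}}_i + b_0 - \boldsymbol{a}^\top\boldsymbol{x}\big) \ge t - s_i \;\forall i\in[N]\right\}.$$ *)

(* Defs.v *)
From HB Require Import structures.
From mathcomp Require Import all_boot all_order all_algebra.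
From mathcomp Require Import boolp classical_sets reals convex topology normedtype.

Set Implicit Arguments.
Unset Strict Implicit.
Unset Printing Implicit Defensive.

Import Order.TTheory GRing.Theory Num.Theory.
Import numFieldNormedType.Exports.

Local Open Scope classical_set_scope.
Local Open Scope ring_scope.

Definition dotv (R : realType) (n : nat) (u v : 'cV[R]_n) : R :=
  (u^T *m v) 0 0.

Definition polyhedron (R : realType) (n : nat) (X : set 'cV[R]_n) : Prop :=
  exists (m : nat) (G : 'M[R]_(m, n)) (h : 'cV[R]_m),
    X = [set x | forall j, (G *m x) j 0 <= h j 0].

(* Nonnegativity and [nu 0 = 0] follow from these axioms.  The canonical norm
   of MathComp-Analysis on matrices is the max-norm, so an arbitrary norm has
   to be given as a function. *)
Definition is_norm (R : realType) (n : nat) (nu : 'cV[R]_n -> R) : Prop :=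
  [/\ forall u v, nu (u + v) <= nu u + nu v,
      forall (c : R) u, nu (c *: u) = `|c| * nu u &
      forall u, nu u = 0 -> u = 0].

(* When [nu] is a norm the set is nonempty and bounded above, so [sup] is the
   genuine least upper bound. *)
Definition dual_norm (R : realType) (n : nat) (nu : 'cV[R]_n -> R)
    (y : 'cV[R]_n) : R :=
  sup [set dotv y z | z in [set z : 'cV[R]_n | nu z <= 1]].

(* Triples (x, s, t); [R^o] is [R] as a module over itself, so that the
   product is an [lmodType R] and [convex_set] applies. *)
Definition icc_space (R : realType) (L N : nat) : lmodType R :=
  ('cV[R]_L * 'cV[R]_N * R^o)%type.

Definition icc_slack (R : realType) (L K : nat) (A : 'M[R]_(L, K))
    (a : 'cV[R]_L) (b : 'cV[R]_K) (b0 : R) (x : 'cV[R]_L) (xi : 'cV[R]_K) : R :=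
  dotv (b - A^T *m x) xi + b0 - dotv a x.

Definition icc_base (R : realType) (L K N : nat) (X : set 'cV[R]_L)
    (A : 'M[R]_(L, K)) (b : 'cV[R]_K) (eps theta : R) (nu : 'cV[R]_K -> R)
    (x : 'cV[R]_L) (s : 'cV[R]_N) (t : R) : Prop :=
  [/\ X x,
      forall i, 0 <= s i 0 &
      eps * N%:R * t - dotv (const_mx 1) s
        >= theta * N%:R * dual_norm nu (b - A^T *m x)].

Definition C_ICC (R : realType) (L K N : nat) (X : set 'cV[R]_L)
    (A : 'M[R]_(L, K)) (a : 'cV[R]_L) (b : 'cV[R]_K) (b0 : R)
    (xi : 'I_N -> 'cV[R]_K) (eps theta : R) (nu : 'cV[R]_K -> R) :
    set (icc_space R L N) :=
  [set w | let: (x, s, t) := w in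
    icc_base X A b eps theta nu x s t /\
    forall i, Num.max (icc_slack A a b b0 x (xi i)) 0 >= t - s i 0].

Definition C_ICC_kappa (R : realType) (L K N : nat) (X : set 'cV[R]_L)
    (A : 'M[R]_(L, K)) (a : 'cV[R]_L) (b : 'cV[R]_K) (b0 : R)
    (xi : 'I_N -> 'cV[R]_K) (eps theta : R) (nu : 'cV[R]_K -> R)
    (kappa : 'I_N -> R) : set (icc_space R L N) :=
  [set w | let: (x, s, t) := w in
    icc_base X A b eps theta nu x s t /\
    forall i, kappa i * icc_slack A a b b0 x (xi i) >= t - s i 0].

(* Main.v *)
Require Import Defs.
From HB Require Import structures.
From mathcomp Require Import all_boot all_order all_algebra.
From mathcomp Require Import boolp classical_sets reals convex topology normedtype.
From mathcomp Require Import interval_inference ring lra.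

Set Implicit Arguments.
Unset Strict Implicit.
Unset Printing Implicit Defensive.

Import Order.TTheory GRing.Theory Num.Theory.
Import numFieldNormedType.Exports.

Local Open Scope classical_set_scope.
Local Open Scope ring_scope.

(** The positive part of a number is the largest of its multiples by factors
    in [0, 1], so every C_ICC(kappa) lies in C_ICC, and a multiplier has to be
    found only for the other inclusion.  The multipliers of the different
    samples do not interact: for each sample i the pair consisting of
    f = slack of the i-th sample and g = t - s_i is an affine image of the
    convex set W, hence a planar convex set lying below the graph of
    u |-> u^+.  Lemma [convex_below_pos_part] supplies a line through the
    origin of slope in [0, 1] that separates them.

    The points with f > 0 ask for a slope of at least g / f, those with f < 0
    for a slope of at most g / f, and those with f = 0 ask for nothing.  The
    slopes 0 and 1 are compatible with these bounds because g <= f^+.  A lower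
    bound and an upper bound are compatible because the segment joining their
    points crosses the axis f = 0, where g <= 0; this is the only use of
    convexity.  The supremum of the lower bounds is therefore a valid slope. *)

(** The segment from x to y contains a point with f = 0. The sign of g there,
    cleared of the denominator f x - f y, is the inequality between the
    slopes. *)
Lemma slope_le_of_crossing (R : realType) (E : lmodType R) (W : set E)
    (f g : E -> R) (W_convex : convex_set W)
    (f_affine : forall p x y,
      f (p *: x + (1 - p) *: y) = p * f x + (1 - p) * f y)
    (g_affine : forall p x y,
      g (p *: x + (1 - p) *: y) = p * g x + (1 - p) * g y)
    (g_le0 : forall w, W w -> f w = 0 -> g w <= 0) (x y : E) :
  W x -> W y -> 0 < f x -> f y < 0 -> g x / f x <= g y / f y.
Proof.
move=> Wx Wy fx fy.
have d_gt0 : 0 < f x - f y by lra.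
(* the weight for which the combination of f x and f y vanishes *)
pose p := - f y / (f x - f y).
have p01 : 0 < p < 1.
  by rewrite divr_gt0 ?oppr_gt0//= ltr_pdivrMr// mul1r; lra.
have pE : p * (f x - f y) = - f y by rewrite divfK ?gt_eqF.
have Wz : W (p *: x + (1 - p) *: y).
  have [p_gt0 p_lt1] := andP p01.
  have := W_convex x y (Itv01 (ltW p_gt0) (ltW p_lt1)) (mem_set Wx) (mem_set Wy).
  by move=> /set_mem.
have gz : p * g x + (1 - p) * g y <= 0.
  by rewrite -g_affine; apply: g_le0 => //; rewrite f_affine; lra.
have {}gz : - f y * g x + f x * g y <= 0.
  have -> : - f y * g x + f x * g y =
      (p * g x + (1 - p) * g y) * (f x - f y).
    by rewrite /p; field; rewrite gt_eqF.
  by rewrite mulr_le0_ge0 // ltW.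
by rewrite ler_pdivrMr// mulrAC ler_ndivlMr//; lra.
Qed.

(** The slope is the supremum of those forced by the points with f > 0, with
    0 adjoined to keep it nonnegative. *)
Lemma convex_below_pos_part (R : realType) (E : lmodType R) (W : set E)
    (f g : E -> R) (W_convex : convex_set W)
    (f_affine : forall p x y,
      f (p *: x + (1 - p) *: y) = p * f x + (1 - p) * f y)
    (g_affine : forall p x y,
      g (p *: x + (1 - p) *: y) = p * g x + (1 - p) * g y)
    (g_le : forall w, W w -> g w <= Num.max (f w) 0) :
  exists2 k : R, 0 <= k <= 1 & forall w, W w -> g w <= k * f w.
Proof.
have g_le0 w : W w -> f w <= 0 -> g w <= 0.
  by move=> /g_le + fw; rewrite (max_idPr fw).
pose S := [set 0] `|` [set g w / f w | w in W `&` [set w | 0 < f w]].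
have S0 : S 0 by left.
have S_ub1 : ubound S 1.
  move=> _ [->|[w [Ww /= fw] <-]]; first exact: ler01.
  by rewrite ler_pdivrMr// mul1r (le_trans (g_le _ Ww))// ge_max lexx ltW.
have S_bounded : has_ubound S by exists 1.
exists (sup S).
  rewrite ub_le_sup//=.
  by apply: ge_sup => //; exists 0.
move=> w Ww; case: (ltgtP (f w) 0) => fw.
- rewrite -ler_ndivlMr//; apply: ge_sup; first by exists 0.
  move=> _ [->|[z [Wz /= fz] <-]].
    by rewrite mulr_le0// ?invr_le0 ?g_le0// ltW.
  apply: (slope_le_of_crossing W_convex f_affine g_affine) => //.
  by move=> v Wv fv; rewrite g_le0// fv.
- rewrite -ler_pdivrMr//; apply: ub_le_sup => //.
  by right; exists w.
- by rewrite fw mulr0 g_le0// fw.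
Qed.

Lemma dotvDl (R : realType) (n : nat) (u v w : 'cV[R]_n) :
  dotv (u + v) w = dotv u w + dotv v w.
Proof. by rewrite /dotv linearD mulmxDl mxE. Qed.

Lemma dotvZl (R : realType) (n : nat) (c : R) (u w : 'cV[R]_n) :
  dotv (c *: u) w = c * dotv u w.
Proof. by rewrite /dotv linearZ -scalemxAl mxE. Qed.

Lemma dotvNl (R : realType) (n : nat) (u w : 'cV[R]_n) :
  dotv (- u) w = - dotv u w.
Proof. by rewrite -scaleN1r dotvZl mulN1r. Qed.

Lemma dotvDr (R : realType) (n : nat) (u v w : 'cV[R]_n) :
  dotv w (u + v) = dotv w u + dotv w v.
Proof. by rewrite /dotv mulmxDr mxE. Qed.

Lemma dotvZr (R : realType) (n : nat) (c : R) (u w : 'cV[R]_n) :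
  dotv w (c *: u) = c * dotv w u.
Proof. by rewrite /dotv -scalemxAr mxE. Qed.

Lemma icc_slack_affine (R : realType) (L K : nat) (A : 'M[R]_(L, K))
    (a : 'cV[R]_L) (b : 'cV[R]_K) (b0 : R) (xi : 'cV[R]_K) (p : R)
    (x y : 'cV[R]_L) :
  icc_slack A a b b0 (p *: x + (1 - p) *: y) xi =
  p * icc_slack A a b b0 x xi + (1 - p) * icc_slack A a b b0 y xi.
Proof.
rewrite /icc_slack mulmxDr -!scalemxAr.
by rewrite !(dotvDl, dotvNl, dotvZl, dotvDr, dotvZr); ring.
Qed.

Theorem proposition3 (R : realType) (L K N : nat)
    (X : set 'cV[R]_L) (A : 'M[R]_(L, K)) (a : 'cV[R]_L) (b : 'cV[R]_K) (b0 : R)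
    (xi : 'I_N -> 'cV[R]_K) (eps theta : R) (nu : 'cV[R]_K -> R)
    (X_polyhedron : polyhedron X) (X_compact : compact X)
    (A_b_neq : forall x, X x -> A^T *m x <> b)
    (eps_itv : 0 < eps < 1) (theta_ge0 : 0 <= theta) (nu_norm : is_norm nu)
    (W : set (icc_space R L N)) (W_convex : convex_set W)
    (W_sub : W `<=` C_ICC X A a b b0 xi eps theta nu) :
  exists kappa : 'I_N -> R,
    [/\ forall i, 0 <= kappa i <= 1,
        W `<=` C_ICC_kappa X A a b b0 xi eps theta nu kappa &
        C_ICC_kappa X A a b b0 xi eps theta nu kappa
          `<=` C_ICC X A a b b0 xi eps theta nu].
Proof.
have slope (i : 'I_N) : exists k : R, 0 <= k <= 1 /\ forall w, W w ->
    w.2 - w.1.2 i 0 <= k * icc_slack A a b b0 w.1.1 (xi i).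
  have [||w Ww|k k01 Wk] := @convex_below_pos_part R _ W
    (fun w => icc_slack A a b b0 w.1.1 (xi i)) (fun w => w.2 - w.1.2 i 0)
    W_convex.
  - by move=> p x y; exact: icc_slack_affine.
  - move=> p x y /=; rewrite !mxE /GRing.scale /=; ring.
  - by move: w Ww => [[x s] t] /W_sub[_ /(_ i)].
  - by exists k.
have [kappa kappaP] := choice slope.
exists kappa; split=> [i|[[x s] t] Wxst|[[x s] t] [base le_kappa]].
- by have [] := kappaP i.
- split=> [|i]; first by have [] := W_sub _ Wxst.
  by have [_ /(_ _ Wxst)] := kappaP i.
- split=> // i; apply: le_trans (le_kappa i) _.
  have [/andP[k0 k1] _] := kappaP i.
  rewrite le_max; have [u0|u0] := leP 0 (icc_slack A a b b0 x (xi i)).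
    by rewrite ler_piMl.
  by rewrite orbC mulr_ge0_le0// ltW.
Qed.
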